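(* Let $m\ge 2$ and let $A=\mathbb{F}Q/I$ be the Auslander algebra of a radical square zero algebra of type $\mathbb{A}$, i.e. $Q$ is the quiver \[ 1\xrightarrow{a_1}2\xrightarrow{a_2}\cdots\xrightarrow{a_{2m-3}}2m-2\xrightarrow{a_{2m-2}}2m-1 \] and $I$ is the ideal generated by the relations $a_{2j-1}a_{2j}=0$ for $1\le j\le m-1$. Then the number of exceptional pairs of $A$ is $12$ if $m=2$, and $25m^2-77m+68$ if $m\ge 3$.
   Context: $\mathbb{F}$ is an algebraically closed field. $a_{2j-1}a_{2j}$ denotes the path of length two from vertex $2j-1$ to vertex $2j+1$. Modules are finite-dimensional and identified with finite-dimensional representations of $Q$ (linear maps $V_i\to V_{i+1}$) satisfying the relations in $I$. A pair $(M,N)$ of $A$-modules is an exceptional pair if $\operatorname{Hom}_A(N,M)\cong 0$ and $\operatorname{Ext}^i_A(N,M)\cong 0$ for all $i\ge 1$. The number of exceptional pairs is the number of ordered pairs $(M,N)$ of isomorphism classes of indecomposable modules that are exceptional pairs. *)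

(* Defs.v *)
From HB Require Import structures.
From mathcomp Require Import all_boot all_order all_algebra.

Set Implicit Arguments.
Unset Strict Implicit.
Unset Printing Implicit Defensive.

Import GRing.Theory.

Local Open Scope ring_scope.

(* Vertices are numbered from 0: i : vertex m stands for the vertex i + 1 of  *)
(* the quiver 1 -> 2 -> ... -> 2m-1.                                          *)
Definition vertex (m : nat) := 'I_(2 * m - 1).

Definition arrow (m : nat) : rel (vertex m) := fun i j => i.+1 == j :> nat.
Arguments arrow {m} i j.

(* A finite-dimensional representation of the bound quiver (Q, I), that is, a *)
(* finite-dimensional A-module.  The generator a_(2j-1) a_(2j) of I is the    *)
(* path of length two starting at the vertex 2j - 1, whose index here is the  *)
(* even number 2j - 2; 1 <= j <= m - 1 exhausts all such paths.               *)
Record rep (F : fieldType) (m : nat) := Rep {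
  space :> vertex m -> vectType F;
  rmap : forall i j, arrow i j -> 'Hom(space i, space j);
  rmap_rel : forall i j k (a : arrow i j) (b : arrow j k),
    ~~ odd i -> (rmap b \o rmap a)%VF = 0
}.
Arguments rmap {F m} r {i j} a.

Record hom (F : fieldType) (m : nat) (M N : rep F m) := MkHom {
  hom_fun :> forall i, 'Hom(M i, N i);
  hom_comm : forall i j (a : arrow i j),
    (hom_fun j \o rmap M a)%VF = (rmap N a \o hom_fun i)%VF
}.

Definition hom_eq0 (F : fieldType) (m : nat) (M N : rep F m) (f : hom M N) :=
  forall i, f i = 0.

Definition epi (F : fieldType) (m : nat) (M N : rep F m) (f : hom M N) :=
  forall i, limg (f i) = fullv.

Definition exact_at (F : fieldType) (m : nat) (L M N : rep F m)
    (f : hom L M) (g : hom M N) :=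
  forall i, limg (f i) = lker (g i).

Definition iso (F : fieldType) (m : nat) (M N : rep F m) :=
  exists f : hom M N, forall i, bijective (f i).

Definition is_zero (F : fieldType) (m : nat) (M : rep F m) :=
  forall i, \dim {: M i} = 0%N.

Definition dsum_fun (F : fieldType) (V V' W W' : vectType F)
    (f : 'Hom(V, V')) (g : 'Hom(W, W')) (p : (V * W)%type) : (V' * W')%type :=
  (f p.1, g p.2).

Lemma dsum_fun_is_linear (F : fieldType) (V V' W W' : vectType F)
    (f : 'Hom(V, V')) (g : 'Hom(W, W')) : linear (dsum_fun f g).
Proof. by move=> a u v; rewrite /dsum_fun /= !linearP. Qed.

HB.instance Definition _ (F : fieldType) (V V' W W' : vectType F)
    (f : 'Hom(V, V')) (g : 'Hom(W, W')) :=
  GRing.isLinear.Build F (V * W)%type (V' * W')%type *:%R (dsum_fun f g)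
    (dsum_fun_is_linear f g).

Definition dsum_map (F : fieldType) (V V' W W' : vectType F)
    (f : 'Hom(V, V')) (g : 'Hom(W, W')) : 'Hom((V * W)%type, (V' * W')%type) :=
  linfun (dsum_fun f g).

Lemma dsum_mapE (F : fieldType) (V V' W W' : vectType F)
    (f : 'Hom(V, V')) (g : 'Hom(W, W')) (p : (V * W)%type) :
  dsum_map f g p = (f p.1, g p.2).
Proof. exact: lfunE. Qed.

Lemma dsum_rel (F : fieldType) (m : nat) (X Y : rep F m)
    i j k (a : arrow i j) (b : arrow j k) : ~~ odd i ->
  (dsum_map (rmap X b) (rmap Y b) \o dsum_map (rmap X a) (rmap Y a))%VF = 0.
Proof.
move=> ev; apply/lfunP => p.
rewrite comp_lfunE !dsum_mapE /= -!comp_lfunE !rmap_rel //.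
by rewrite !zero_lfunE.
Qed.

Definition dsum (F : fieldType) (m : nat) (X Y : rep F m) : rep F m :=
  @Rep F m (fun i => (X i * Y i)%type)
    (fun i j a => dsum_map (rmap X a) (rmap Y a)) (@dsum_rel F m X Y).

Definition indecomposable (F : fieldType) (m : nat) (M : rep F m) :=
  ~ is_zero M /\
  forall X Y : rep F m, iso M (dsum X Y) -> is_zero X \/ is_zero Y.

Definition projective (F : fieldType) (m : nat) (P : rep F m) :=
  forall (X Y : rep F m) (g : hom X Y) (f : hom P Y), epi g ->
  exists h : hom P X, forall i, f i = (g i \o h i)%VF.

Record proj_resolution (F : fieldType) (m : nat) (N : rep F m) := ProjRes {
  res_obj :> nat -> rep F m;
  res_diff : forall k, hom (res_obj k.+1) (res_obj k);
  res_aug : hom (res_obj 0%N) N;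
  res_proj : forall k, projective (res_obj k);
  res_epi : epi res_aug;
  res_exact0 : exact_at (res_diff 0%N) res_aug;
  res_exactS : forall k, exact_at (res_diff k.+1) (res_diff k)
}.

(* Cocycles and coboundaries of the complex                                   *)
(*   0 -> Hom(P_0, M) -> Hom(P_1, M) -> Hom(P_2, M) -> ...                    *)
Definition cocycle (F : fieldType) (m : nat) (N M : rep F m)
    (P : proj_resolution N) (k : nat) (f : hom (P k) M) :=
  forall i, (f i \o res_diff P k i)%VF = 0.

Definition coboundary (F : fieldType) (m : nat) (N M : rep F m)
    (P : proj_resolution N) (k : nat) : hom (P k) M -> Prop :=
  match k with
  | 0 => fun f => hom_eq0 f
  | l.+1 => fun f => exists g : hom (P l) M,
      forall i, f i = (g i \o res_diff P l i)%VF
  end.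

(* Ext^k(N, M) = 0: the k-th cohomology of Hom(P, M) vanishes for a           *)
(* projective resolution P of N; by the comparison theorem the choice of P is *)
(* immaterial.                                                                *)
Definition Ext_eq0 (F : fieldType) (m : nat) (k : nat) (N M : rep F m) :=
  exists P : proj_resolution N,
    forall f : hom (P k) M, cocycle f -> coboundary f.

Definition exceptional_pair (F : fieldType) (m : nat) (M N : rep F m) :=
  (forall f : hom N M, hom_eq0 f) /\
  (forall k : nat, (1 <= k)%N -> Ext_eq0 k N M).

(* There are exactly c classes, for the equivalence E, of objects with P.     *)
Definition num_classes (T : Type) (E : T -> T -> Prop) (P : T -> Prop)
    (c : nat) :=
  exists s : 'I_c -> T,
    [/\ forall k, P (s k),
        forall k l, E (s k) (s l) -> k = l
      & forall x, P x -> exists k, E x (s k)].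

Definition num_exceptional_pairs (F : fieldType) (m c : nat) :=
  num_classes
    (fun p q : rep F m * rep F m => iso p.1 q.1 /\ iso p.2 q.2)
    (fun p => [/\ indecomposable p.1, indecomposable p.2
                & exceptional_pair p.1 p.2])
    c.

(* Main.v *)
From HB Require Import structures.
From mathcomp Require Import all_boot all_order all_algebra.
From mathcomp Require Import zify.
From Stdlib Require Import Classical.
Require Import Defs.

(** Vertices are numbered from 0. Write reach a for a + 1 if a is even and for
    a + 2 if a is odd: in the quiver prolonged to infinity, this is the last
    vertex reached from a by a nonzero path. The algebra is a Nakayama algebra,
    and the proof rests on the following facts.

    Its indecomposable modules are the interval modules [a, b] with
    a <= b <= reach a. Such a module is indecomposable because it is generated
    by a line ([itv_indecomposable]). Conversely, in a nonzero module M take a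
    nonzero path of maximal length, from a to b, say, and a vector on which it
    does not vanish: this vector generates a submodule [a, b], and maximality
    makes it a direct summand of M ([itv_retract],
    [indecomposable_classification]).

    The indecomposable projectives are the intervals [x, reach x]
    ([itv_projective]). Put x_0 = a, x_1 = b + 1 and
    x_(k+2) = reach x_k + 1. Then [a, b] has a projective resolution with
    terms [x_k, reach x_k], whose k-th syzygy is the interval from x_k to
    x_(k+1) - 1 ([itv_res]); terms beyond the end of the quiver are zero.

    For M = [c, d], the complex Hom(P, M) has a line in each degree k with
    c <= x_k <= d, and its differential is an isomorphism between two such
    lines in consecutive degrees. Hence (M, [a, b]) is exceptional if and only
    if no x_k lying in [c, d] is isolated there, that is, without x_(k-1) and
    x_(k+1) ([exceptional_itv_res]); degrees 0, 1 and 2 suffice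
    ([exceptional_itvP]). That vanishing of Ext may be tested on this one
    resolution is the comparison theorem ([acyclic_at_indep]).

    It remains to count pairs of intervals. The criterion is invariant under
    translation by two vertices and holds for all pairs of distant intervals.
    For m >= 3, passing from m to m + 1 adds five intervals at the end of the
    quiver, and a number of exceptional pairs that is affine in m
    ([num_exc_intervals]). *)

Set Implicit Arguments.
Unset Strict Implicit.
Unset Printing Implicit Defensive.

Import GRing.Theory.

Local Open Scope ring_scope.

(** * Homomorphisms, kernels and splittings *)

Section Homomorphisms.

Context {F : fieldType} {m : nat}.
Implicit Types L M N P : rep F m.

Lemma homE M N (f : hom M N) i j (a : arrow i j) v :
  f j (rmap M a v) = rmap N a (f i v).
Proof. by rewrite -!comp_lfunE hom_comm. Qed.

Definition hom_of M N (h : forall i, 'Hom(M i, N i))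
    (hE : forall i j (a : arrow i j) v,
       h j (rmap M a v) = rmap N a (h i v)) : hom M N.
Proof.
by exists h => i j a; apply/lfunP => v; rewrite !comp_lfunE hE.
Defined.

Definition hom_id M : hom M M.
Proof. by exists (fun i => \1%VF) => i j a; rewrite comp_lfun1l comp_lfun1r. Defined.

Definition hom_comp L M N (g : hom M N) (f : hom L M) : hom L N.
Proof.
exists (fun i => (g i \o f i)%VF) => i j a.
by rewrite -comp_lfunA hom_comm !comp_lfunA hom_comm.
Defined.

Definition hom_zero M N : hom M N.
Proof. by exists (fun i => 0) => i j a; rewrite comp_lfun0l comp_lfun0r. Defined.

Definition hom_sub M N (f g : hom M N) : hom M N.
Proof.
exists (fun i => f i - g i) => i j a.
by apply/lfunP => v; rewrite !comp_lfunE !(add_lfunE, opp_lfunE) !homE linearB.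
Defined.

Lemma hom_idE M i v : hom_id M i v = v.
Proof. exact: id_lfunE. Qed.

Lemma hom_compE L M N (g : hom M N) (f : hom L M) i v :
  hom_comp g f i v = g i (f i v).
Proof. exact: comp_lfunE. Qed.

Lemma hom_subE M N (f g : hom M N) i v : hom_sub f g i v = f i v - g i v.
Proof. by rewrite /= add_lfunE opp_lfunE. Qed.

Definition hom_simp := (hom_idE, hom_compE, hom_subE).

Lemma limg_lkerP (U V W : vectType F) (f : 'Hom(U, V)) (g : 'Hom(V, W)) :
  limg f = lker g <->
  (forall u, g (f u) = 0) /\ (forall v, g v = 0 -> exists u, v = f u).
Proof.
split=> [fg|[gf0 fg]].
  split=> [u|v gv0]; first by apply/eqP; rewrite -memv_ker -fg memv_img ?memvf.
  by have /memv_imgP[u _ ->] : v \in limg f; [rewrite fg memv_ker gv0 | exists u].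
apply/eqP; rewrite eqEsubv; apply/andP; split; apply/subvP => v.
  by case/memv_imgP => u _ ->; rewrite memv_ker gf0.
by rewrite memv_ker => /eqP/fg[u ->]; rewrite memv_img ?memvf.
Qed.

Lemma limg_fullP (U V : vectType F) (f : 'Hom(U, V)) :
  limg f = fullv <-> forall v, exists u, v = f u.
Proof.
split=> [ff v|ff].
  by have /memv_imgP[u _ ->] : v \in limg f; [rewrite ff memvf | exists u].
apply/eqP; rewrite eqEsubv subvf; apply/subvP => v _.
by have [u ->] := ff v; rewrite memv_img ?memvf.
Qed.

Lemma hom_inv M N (f : hom M N) : (forall i, bijective (f i)) ->
  exists g : hom N M, (forall i, cancel (f i) (g i)) /\
                      (forall i, cancel (g i) (f i)).
Proof.
move=> bf.
have fK i : cancel (f i) (f i)^-1%VF.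
  by apply: lker0_lfunK; apply/lker0P/bij_inj.
have Kf i : cancel (f i)^-1%VF (f i) by apply/(bij_can_sym (bf i)); exact: fK.
have gE i j (a : arrow i j) v :
    (f j)^-1%VF (rmap N a v) = rmap M a ((f i)^-1%VF v).
  by apply: (bij_inj (bf j)); rewrite Kf homE Kf.
by exists (hom_of gE); split=> i v; [exact: fK | exact: Kf].
Qed.

Lemma iso_sym M N : iso M N -> iso N M.
Proof.
by case=> f /hom_inv[g [fg gf]]; exists g => i; exists (f i).
Qed.

Lemma is_zeroP M : is_zero M <-> forall i (v : M i), v = 0.
Proof.
split=> [M0 i v|M0 i].
  have /eqP := M0 i; rewrite dimv_eq0 => /eqP V0.
  by apply/eqP; rewrite -memv0 -V0 memvf.
apply/eqP; rewrite dimv_eq0 -subv0; apply/subvP => v _.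
by rewrite (M0 i v) mem0v.
Qed.

(** The pointwise kernel is a subrepresentation; it inherits the relations
    from the ambient representation. *)
Section Kernel.

Variables (M N : rep F m) (f : hom M N).

Definition ker_map i j (a : arrow i j) :
    'Hom(subvs_of (lker (f i)), subvs_of (lker (f j))) :=
  (linfun (vsproj (lker (f j))) \o rmap M a \o linfun vsval)%VF.

Lemma ker_mapE i j (a : arrow i j) (v : subvs_of (lker (f i))) :
  vsval (ker_map a v) = rmap M a (vsval v).
Proof.
rewrite /ker_map !comp_lfunE !lfunE /= vsprojK // memv_ker homE.
by have := subvsP v; rewrite memv_ker => /eqP ->; rewrite linear0.
Qed.

Lemma ker_rel i j k (a : arrow i j) (b : arrow j k) :
  ~~ odd i -> (ker_map b \o ker_map a)%VF = 0.
Proof.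
move=> ev; apply/lfunP => v; apply: subvs_inj.
by rewrite comp_lfunE !ker_mapE -comp_lfunE rmap_rel // !lfunE linear0.
Qed.

Definition ker_rep : rep F m := Rep ker_rel.

Lemma ker_lift L (g : hom L M) : (forall i v, f i (g i v) = 0) ->
  exists h : hom L ker_rep, forall i v, vsval (h i v) = g i v.
Proof.
move=> fg0.
pose h i : 'Hom(L i, ker_rep i) := (linfun (vsproj (lker (f i))) \o g i)%VF.
have hE i v : vsval (h i v) = g i v.
  by rewrite comp_lfunE lfunE /= vsprojK // memv_ker fg0.
have hc i j (a : arrow i j) v : h j (rmap L a v) = rmap ker_rep a (h i v).
  by apply: subvs_inj; rewrite ker_mapE !hE homE.
by exists (hom_of hc).
Qed.

End Kernel.

(** Since f and d take values in the kernel of g, both corestrict to the kernel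
    representation, and d becomes an epimorphism there. *)
Lemma projective_lift L M N P (d : hom L M) (g : hom M N) (f : hom P M) :
  projective P -> exact_at d g -> (forall i v, g i (f i v) = 0) ->
  exists h : hom P L, forall i v, d i (h i v) = f i v.
Proof.
move=> projP ex gf0.
have exP i := (limg_lkerP (d i) (g i)).1 (ex i).
have [d' d'E] := ker_lift (fun i => (exP i).1).
have [f' f'E] := ker_lift gf0.
have d'_epi : epi d'.
  move=> i; apply/limg_fullP => v.
  have /(exP i).2[u vE] : g i (vsval v) = 0.
    by apply/eqP; rewrite -memv_ker subvsP.
  by exists u; apply: subvs_inj; rewrite d'E.
have [h hE] := projP _ _ d' f' d'_epi.
by exists h => i v; rewrite -d'E -f'E hE comp_lfunE.
Qed.

(** The isomorphism is v |-> (f v, v - s (f v)), with inverse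
    (x, y) |-> s x + y. *)
Lemma retract_splits M N (f : hom M N) (s : hom N M) :
  (forall i, cancel (s i) (f i)) -> iso M (dsum N (ker_rep f)).
Proof.
move=> sK.
have k0 i v : f i (hom_sub (hom_id M) (hom_comp s f) i v) = 0.
  by rewrite !hom_simp linearB /= sK subrr.
have [p pE] := ker_lift k0.
pose h i : M i -> dsum N (ker_rep f) i := fun v => (f i v, p i v).
have h_lin i : linear (h i) by move=> c u v; rewrite /h !linearP.
pose hL i := GRing.isLinear.Build F _ _ _ (h i) (h_lin i).
pose h' i : {linear M i -> dsum N (ker_rep f) i} := HB.pack (h i) (hL i).
pose l i : 'Hom(M i, dsum N (ker_rep f) i) := linfun (h' i).
have hE i v : l i v = (f i v, p i v) by rewrite lfunE.
have hc i j (a : arrow i j) v :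
    l j (rmap M a v) = rmap (dsum N (ker_rep f)) a (l i v).
  by rewrite !hE dsum_mapE /= homE; congr (_, _); exact: (homE p a v).
exists (hom_of hc) => i.
exists (fun x => s i x.1 + vsval x.2) => [v|[x y]]; rewrite /= hE /=.
  by rewrite pE !hom_simp addrC subrK.
have fy : f i (vsval y) = 0 by apply/eqP; rewrite -memv_ker subvsP.
congr (_, _); first by rewrite linearD /= sK fy addr0.
by apply: subvs_inj; rewrite pE !hom_simp linearD /= sK fy addr0 addrAC subrr add0r.
Qed.

End Homomorphisms.

(** * Independence of Ext-vanishing from the resolution *)

Arguments res_proj {F m N} p k X Y g f _.

Section Comparison.

Context {F : fieldType} {m : nat}.
Implicit Types M N : rep F m.

Definition acyclic_at N M (P : proj_resolution N) k :=
  forall f : hom (P k) M, cocycle f -> coboundary f.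

Lemma res_augd N (P : proj_resolution N) i v :
  res_aug P i (res_diff P 0 i v) = 0.
Proof. exact: ((limg_lkerP _ _).1 (res_exact0 P i)).1. Qed.

Lemma res_dd N (P : proj_resolution N) k i v :
  res_diff P k i (res_diff P k.+1 i v) = 0.
Proof. exact: ((limg_lkerP _ _).1 (res_exactS P k i)).1. Qed.

Lemma res_lift N (P : proj_resolution N) k (Q : rep F m) (f : hom Q (P k.+1)) :
  projective Q -> (forall i v, res_diff P k i (f i v) = 0) ->
  exists h : hom Q (P k.+2), forall i v, res_diff P k.+1 i (h i v) = f i v.
Proof. by move=> projQ; apply: projective_lift (res_exactS P k). Qed.

Lemma res_lift_aug N (P : proj_resolution N) (Q : rep F m) (f : hom Q N) :
  projective Q -> exists h : hom Q (P 0), forall i v, res_aug P i (h i v) = f i v.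
Proof.
move=> projQ; have [h hE] := projQ _ _ _ f (res_epi P).
by exists h => i v; rewrite hE comp_lfunE.
Qed.

Lemma res_lift0 N (P : proj_resolution N) (Q : rep F m) (f : hom Q (P 0)) :
  projective Q -> (forall i v, res_aug P i (f i v) = 0) ->
  exists h : hom Q (P 1), forall i v, res_diff P 0 i (h i v) = f i v.
Proof. by move=> projQ; apply: projective_lift (res_exact0 P). Qed.

(** The part of a comparison of P with P' that lives around degree k: chain
    maps phi : P' -> P and psi : P -> P' over the identity of N, and the top
    component h of a chain homotopy from the identity to psi phi. Of the
    homotopy identity psi phi - 1 = d h + h' d only its composite with d is
    recorded: the lower component h' then disappears, and the existence of
    such data can be proved by induction on k. *)
Definition comparable N (P P' : proj_resolution N) k :=
  exists (phi : hom (P' k) (P k)) (phi1 : hom (P' k.+1) (P k.+1))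
         (psi : hom (P k) (P' k)) (psi1 : hom (P k.+1) (P' k.+1))
         (h : hom (P' k) (P' k.+1)),
  [/\ forall i v, res_diff P k i (phi1 i v) = phi i (res_diff P' k i v),
      forall i v, res_diff P' k i (psi1 i v) = psi i (res_diff P k i v)
    & forall i v, let u := res_diff P' k i v in
        psi i (phi i u) - u - res_diff P' k i (h i u) = 0].

Lemma comparable0 N (P P' : proj_resolution N) : comparable P P' 0.
Proof.
have [phi phiE] := res_lift_aug P (res_aug P') (res_proj P' 0).
have [psi psiE] := res_lift_aug P' (res_aug P) (res_proj P 0).
have [|phi1 phi1E] :=
    @res_lift0 _ P _ (hom_comp phi (res_diff P' 0)) (res_proj P' 1).
  by move=> i v; rewrite hom_simp phiE res_augd.
have [|psi1 psi1E] :=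
    @res_lift0 _ P' _ (hom_comp psi (res_diff P 0)) (res_proj P 1).
  by move=> i v; rewrite hom_simp psiE res_augd.
have [|h hE] := @res_lift0 _ P' _
    (hom_sub (hom_comp psi phi) (hom_id (P' 0))) (res_proj P' 0).
  by move=> i v; rewrite !hom_simp linearB /= psiE phiE subrr.
exists phi, phi1, psi, psi1, h; split=> i v; first by rewrite phi1E hom_simp.
  by rewrite psi1E hom_simp.
by rewrite /= hE !hom_simp subrr.
Qed.

(** One induction step: lift phi, psi and the homotopy one degree further;
    [h1] is the new component and satisfies the full homotopy identity. *)
Lemma comparable_step N (P P' : proj_resolution N) k : comparable P P' k ->
  exists (phi : hom (P' k) (P k)) (phi1 : hom (P' k.+1) (P k.+1))
         (psi1 : hom (P k.+1) (P' k.+1)) (psi2 : hom (P k.+2) (P' k.+2))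
         (h : hom (P' k) (P' k.+1)) (h1 : hom (P' k.+1) (P' k.+2)),
  [/\ forall i v, res_diff P k i (phi1 i v) = phi i (res_diff P' k i v),
      forall i v, res_diff P' k.+1 i (psi2 i v) = psi1 i (res_diff P k.+1 i v),
      forall i v, psi1 i (phi1 i v) - v
                  = res_diff P' k.+1 i (h1 i v) + h i (res_diff P' k i v)
    & comparable P P' k.+1].
Proof.
case=> phi [phi1 [psi [psi1 [h [phiE psiE hE]]]]].
have [|phi2 phi2E] :=
    @res_lift _ P k _ (hom_comp phi1 (res_diff P' k.+1)) (res_proj P' k.+2).
  by move=> i v; rewrite hom_simp phiE res_dd linear0.
have [|psi2 psi2E] :=
    @res_lift _ P' k _ (hom_comp psi1 (res_diff P k.+1)) (res_proj P k.+2).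
  by move=> i v; rewrite hom_simp psiE res_dd linear0.
have [|h1 h1E] := @res_lift _ P' k _ (hom_sub (hom_sub (hom_comp psi1 phi1)
    (hom_id (P' k.+1))) (hom_comp h (res_diff P' k))) (res_proj P' k.+1).
  by move=> i v; rewrite !hom_simp !linearB /= psiE phiE hE.
exists phi, phi1, psi1, psi2, h, h1; split=> [//|i v|i v|].
- by rewrite psi2E hom_simp.
- by rewrite h1E !hom_simp subrK.
exists phi1, phi2, psi1, psi2, h1; split=> i v /=.
- by rewrite phi2E hom_simp.
- by rewrite psi2E hom_simp.
by rewrite h1E !hom_simp res_dd linear0 subr0 subrr.
Qed.

Lemma comparableP N (P P' : proj_resolution N) k : comparable P P' k.
Proof.
elim: k => [|k IH]; first exact: comparable0.
by have [? [? [? [? [? [? []]]]]]] := comparable_step IH.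
Qed.

(** A cocycle f on P' becomes f psi on P, hence g d, and then
    f = f psi phi - f h d = (g phi - f h) d. *)
Lemma acyclic_at_indep N M (P P' : proj_resolution N) k :
  acyclic_at M P k.+1 -> acyclic_at M P' k.+1.
Proof.
move=> acP f f_coc.
have fd i v : f i (res_diff P' k.+1 i v) = 0.
  by rewrite -comp_lfunE f_coc lfunE.
have [phi [phi1 [psi1 [psi2 [h [h1 [phiE psiE hE _]]]]]]] :=
  comparable_step (comparableP P P' k).
have [|g gE] := acP (hom_comp f psi1).
  by move=> i; apply/lfunP => v; rewrite lfunE /= hom_simp -psiE fd lfunE.
exists (hom_sub (hom_comp g phi) (hom_comp f h)) => i; apply/lfunP => v.
rewrite comp_lfunE !hom_simp -phiE.
have := gE i; move/lfunP/(_ (phi1 i v)); rewrite hom_simp comp_lfunE => <-.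
have /(congr1 (f i)) := hE i v.
by rewrite linearB linearD /= fd add0r => <-; rewrite subKr.
Qed.

End Comparison.

(** * Invariance under isomorphism *)

Section Invariance.

Context {F : fieldType} {m : nat}.
Implicit Types M N : rep F m.

Lemma Ext_eq0_iso k N N' M M' : iso N N' -> iso M M' ->
  Ext_eq0 k.+1 N M -> Ext_eq0 k.+1 N' M'.
Proof.
case=> n bn [f bf] [P acP].
have epin : epi (hom_comp n (res_aug P)).
  move=> i; apply/limg_fullP => v; have [n' nK n'K] := bn i.
  have [u uE] := (limg_fullP _).1 (res_epi P i) (n' v).
  by exists u; rewrite hom_simp -uE n'K.
have exn : exact_at (res_diff P 0) (hom_comp n (res_aug P)).
  move=> i; rewrite res_exact0; apply/vspaceP => v.
  by rewrite !memv_ker hom_simp -(inj_eq (bij_inj (bn i))) linear0.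
pose P' := ProjRes (res_proj P) epin exn (res_exactS P).
have [g [fg gf]] := hom_inv bf.
exists P' => u u_coc.
have [|w wE] := acP (hom_comp g u).
  move=> i; apply/lfunP => v; rewrite comp_lfunE hom_simp.
  have /lfunP/(_ v) := u_coc i; rewrite comp_lfunE => ->.
  by rewrite !lfunE linear0.
exists (hom_comp f w) => i; apply/lfunP => v.
have /lfunP/(_ v) := wE i; rewrite !comp_lfunE => <-.
by rewrite gf.
Qed.

Lemma exceptional_pair_iso M M' N N' : iso M M' -> iso N N' ->
  exceptional_pair M N -> exceptional_pair M' N'.
Proof.
move=> MM' NN' [H0 Hk]; split=> [f i|[//|k] k_gt0]; last first.
  exact: Ext_eq0_iso NN' MM' (Hk _ k_gt0).
have [n bn] := NN'; have [g bg] := iso_sym MM'.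
apply/lfunP => v; rewrite lfunE; have [n' _ n'K] := bn i.
apply: (bij_inj (bg i)); rewrite linear0 -[v]n'K.
have /lfunP/(_ (n' v)) := H0 (hom_comp g (hom_comp f n)) i.
by rewrite !hom_simp lfunE.
Qed.

End Invariance.

(** * Interval representations *)

(** The space of an interval representation at a vertex consists of the row
    vectors of width 1 or 0, according to whether the vertex lies in the
    interval. Such a row is determined by the sum of its entries, which is its
    coordinate in width 1 and vanishes in width 0; equalities can so be checked
    in F. *)
Section Thin.

Context {F : fieldType}.

Definition entry p (v : 'rV[F]_p) : F := \sum_j v 0 j.

Definition thin p q (c : F) : 'Hom('rV[F]_p, 'rV[F]_q) :=
  linfun (mulmxr (const_mx c)).

Lemma entryD p : {morph @entry p : u v / u + v}.
Proof. by move=> u v; rewrite /entry -big_split; apply: eq_bigr => j _; rewrite !mxE. Qed.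

Lemma entryZ p c v : @entry p (c *: v) = c * entry v.
Proof. by rewrite /entry mulr_sumr; apply: eq_bigr => j _; rewrite mxE. Qed.

Lemma entry0 p : @entry p 0 = 0.
Proof. by rewrite /entry big1 // => j _; rewrite mxE. Qed.

Lemma entry_const p c : @entry p (const_mx c) = c *+ p.
Proof.
by rewrite /entry (eq_bigr (fun=> c)) ?sumr_const ?card_ord // => j _; rewrite mxE.
Qed.

Lemma thinE p q c v : thin p q c v = const_mx (entry v * c).
Proof.
rewrite lfunE /=; apply/matrixP => i j; rewrite !mxE mulr_suml (ord1 i).
by apply: eq_bigr => k _; rewrite mxE.
Qed.

Lemma entry_thin p q c v : entry (thin p q c v) = (entry v * c) *+ q.
Proof. by rewrite thinE entry_const. Qed.

Lemma entry_inj (p : bool) (v w : 'rV[F]_p) :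
  (p -> entry v = entry w) -> v = w.
Proof.
case: p v w => v w vw; last by apply/matrixP => i [].
move/(_ isT): vw; rewrite /entry !big_ord1 => vw.
by apply/matrixP => i j; rewrite !ord1.
Qed.

Lemma entry_out (p : bool) (v : 'rV[F]_p) : ~~ p -> entry v = 0.
Proof. by case: p v => // v _; rewrite /entry big_ord0. Qed.

End Thin.

(** The last vertex reached from a by a path outside the ideal of relations,
    in the quiver prolonged to infinity: a + 1 for a even, a + 2 for a odd. *)
Definition reach a := (a + 1 + odd a)%N.

Definition between a b i := (a <= i <= b)%N.

Section Intervals.

Context {F : fieldType} {m : nat}.
Implicit Types (M N : rep F m) (a b c d x : nat).

Definition itv_space a b (i : vertex m) : vectType F := 'rV[F]_(between a b i).

Definition itv_map a b i j (_ : arrow i j) :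
    'Hom(itv_space a b i, itv_space a b j) :=
  thin (between a b i) (between a b j) ((b <= reach a)%N%:R).

Lemma itv_rel a b i j k (ar : arrow i j) (br : arrow j k) :
  ~~ odd i -> (itv_map a b br \o itv_map a b ar)%VF = 0.
Proof.
move=> ev; apply/lfunP => v; rewrite comp_lfunE zero_lfunE.
apply: entry_inj => kab; rewrite entry0 !entry_thin kab.
have /orP[iab|/entry_out->] := orbN (between a b i); last by rewrite !(mul0r, mul0rn).
rewrite [X in X%:R](_ : _ = 0%N) ?(mulr0, mul0r, mul0rn) //.
move: ar br kab iab ev; rewrite /arrow /between /reach; lia.
Qed.

(** The interval representation: a line at each vertex from a to b. The bounds
    are unrestricted natural numbers: vertices beyond the end of the quiver
    are simply not there, so the projective cover of the simple at a is the
    interval from a to reach a also near the end of the quiver. When reach a < b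
    the structure maps are zero, only to make the definition total. *)
Definition itv a b : rep F m := Rep (@itv_rel a b).

Lemma entry_rmap a b i j (ar : arrow i j) v : (b <= reach a)%N ->
  entry (rmap (itv a b) ar v) = entry (v : 'rV_(between a b i)) *+ between a b j.
Proof. by move=> ab; rewrite /= /itv_map entry_thin ab mulr1. Qed.

Lemma itv_eq a b (i : vertex m) (v w : itv a b i) :
  (between a b i -> entry (v : 'rV_(between a b i)) = entry (w : 'rV_(between a b i)))
  -> v = w.
Proof. exact: entry_inj. Qed.

Definition itv_gen a b (i : vertex m) : itv a b i := const_mx 1.

Lemma entry_gen a b (i : vertex m) :
  entry (itv_gen a b i : 'rV_(between a b i)) = (between a b i)%:R.
Proof. by rewrite entry_const. Qed.

Lemma entry_gen1 a b (i : vertex m) : between a b i ->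
  entry (itv_gen a b i : 'rV_(between a b i)) = 1.
Proof. by rewrite entry_gen => ->. Qed.

Lemma itv_genE a b (i : vertex m) (v : itv a b i) :
  v = entry (v : 'rV_(between a b i)) *: itv_gen a b i.
Proof. by apply: itv_eq => iab; rewrite entryZ entry_gen1 // mulr1. Qed.

Lemma itv_gen_neq0 a b (i : vertex m) : between a b i -> itv_gen a b i <> 0.
Proof.
move=> iab /(congr1 (@entry F _)); rewrite entry0 entry_gen iab.
by move/eqP; rewrite oner_eq0.
Qed.

(** Quotients of [a, b] are its initial segments and subobjects of [c, d] are
    its final segments. When c <= a and d <= b there is thus a map with image
    [a, d], which is zero if d < a. The scalar z is its value on generators. *)
Definition itv_hom (z : F) a b c d
    (H : [&& c <= a, d <= b, b <= reach a & d <= reach c]%N) :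
  hom (itv a b) (itv c d).
Proof.
apply: (@hom_of _ _ (itv a b) (itv c d)
          (fun i => thin (between a b i) (between c d i) z)) => i j ar v.
apply: itv_eq => jcd; case/and4P: H => ca db ab cd.
rewrite entry_thin !entry_rmap // entry_thin jcd !mulr1n.
have /orP[iab|/entry_out->] := orbN (between a b i); last by rewrite !(mul0r, mul0rn).
have [-> ->] : between c d i /\ between a b j.
  by move: ar iab jcd; rewrite /arrow /between; lia.
by [].
Defined.

Lemma itv_homE z a b c d H (i : vertex m) v :
  @itv_hom z a b c d H i v = (entry (v : 'rV_(between a b i)) * z) *: itv_gen c d i.
Proof.
rewrite /= thinE; apply: itv_eq => icd.
by rewrite entry_const entryZ entry_gen icd mulr1.
Qed.

Lemma entry_itv_hom z a b c d H (i : vertex m) v :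
  entry (@itv_hom z a b c d H i v : 'rV_(between c d i))
  = (entry (v : 'rV_(between a b i)) * z) *+ between c d i.
Proof. by rewrite itv_homE entryZ entry_gen mulr_natr. Qed.

(** A map out of an interval is a chain of vectors that follows the arrows up
    to b and is killed by the arrow leaving b. *)
Lemma hom_from_itv M a b (w : forall i, M i) : (b <= reach a)%N ->
  (forall i j (ar : arrow i j), between a b i ->
     rmap M ar (w i) = if (j <= b)%N then w j else 0) ->
  exists f : hom (itv a b) M,
    forall i v, f i v = entry (v : 'rV_(between a b i)) *: w i.
Proof.
move=> ab wE.
pose h i (v : itv a b i) : M i := entry (v : 'rV_(between a b i)) *: w i.
have h_lin i : linear (@h i).
  by move=> z u v; rewrite /h scalerA -scalerDl entryD entryZ.
pose hL i := GRing.isLinear.Build F _ _ _ (@h i) (h_lin i).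
pose h' i : {linear itv a b i -> M i} := HB.pack (@h i) (hL i).
pose l i : 'Hom(itv a b i, M i) := linfun (h' i).
have lE i v : l i v = entry (v : 'rV_(between a b i)) *: w i by rewrite lfunE.
suff lc i j (ar : arrow i j) v : l j (rmap (itv a b) ar v) = rmap M ar (l i v).
  by exists (hom_of lc).
rewrite !lE entry_rmap // linearZ /=.
have /orP[iab|/entry_out->] := orbN (between a b i); last by rewrite mul0rn !scale0r.
rewrite wE //; have -> : between a b j = (j <= b)%N.
  by move: ar iab; rewrite /arrow /between; lia.
by case: leqP => _; rewrite ?scale0r ?scaler0.
Qed.

(** Dually, a map to an interval is a chain of linear forms; the form at a
    vanishes on the image of the arrow entering a. *)
Lemma hom_to_itv M a b (psi : forall i, 'Hom(M i, F^o)) : (b <= reach a)%N ->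
  (forall i j (ar : arrow i j) v, between a b j ->
     psi j (rmap M ar v) = psi i v *+ between a b i) ->
  exists f : hom M (itv a b),
    forall i v, f i v = (psi i v : F) *: itv_gen a b i.
Proof.
move=> ab psiE.
pose h i (v : M i) : itv a b i := (psi i v : F) *: itv_gen a b i.
have h_lin i : linear (@h i) by move=> z u v; rewrite /h linearP scalerDl -scalerA.
pose hL i := GRing.isLinear.Build F _ _ _ (@h i) (h_lin i).
pose h' i : {linear M i -> itv a b i} := HB.pack (@h i) (hL i).
pose l i : 'Hom(M i, itv a b i) := linfun (h' i).
have lE i v : l i v = (psi i v : F) *: itv_gen a b i by rewrite lfunE.
suff lc i j (ar : arrow i j) v : l j (rmap M ar v) = rmap (itv a b) ar (l i v).
  by exists (hom_of lc).
apply: itv_eq => jab; rewrite entry_rmap // !lE !entryZ !entry_gen.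
by rewrite psiE // jab mulr1n mulr1 mulr_natr.
Qed.

(** The space of an interval at its first vertex generates the others. *)
Lemma itv_hom_eq0 M a b (f : hom (itv a b) M) : (b <= reach a)%N ->
  (forall i : vertex m, i = a :> nat -> (a <= b)%N -> f i (itv_gen a b i) = 0) ->
  forall i v, f i v = 0.
Proof.
move=> ab fa i v; rewrite (itv_genE v) linearZ /=.
have /orP[iab|/entry_out->] := orbN (between a b i); last by rewrite scale0r.
suff -> : f i (itv_gen a b i) = 0 by rewrite scaler0.
have [n ni] : exists n, i = (a + n)%N :> nat.
  by exists (i - a)%N; move: iab; rewrite /between; lia.
elim: n i ni iab {v} => [|n IH] i ni iab.
  by apply: fa; move: iab; rewrite /between; lia.
have jn : (a + n < 2 * m - 1)%N by have := ltn_ord i; lia.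
have ar : arrow (Ordinal jn) i by rewrite /arrow /= ni addnS.
have jab : between a b (Ordinal jn) by move: iab; rewrite /between /=; lia.
rewrite (_ : itv_gen a b i = rmap (itv a b) ar (itv_gen a b (Ordinal jn))).
  by rewrite homE IH // linear0.
by apply: itv_eq => _; rewrite entry_rmap // !entry_gen iab jab.
Qed.

End Intervals.
Arguments itv {F m} a b.

(** * Sections and projective intervals *)

Section Sections.

Context {F : fieldType} {m : nat} {M : rep F m}.
Implicit Types (u : forall i, M i).

Definition prev_vertex (j : vertex m) : vertex m :=
  Ordinal (leq_ltn_trans (leq_pred j) (ltn_ord j)).

Lemma arrow_prev (j : vertex m) : (0 < j)%N -> arrow (prev_vertex j) j.
Proof. by move=> j0; rewrite /arrow /= prednK. Qed.

Lemma section_through (i : vertex m) (v : M i) :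
  exists u : forall i, M i, u i = v.
Proof.
exists (@dfwith (vertex m) (fun i => M i : Type) (fun=> 0) i v).
exact: (@dfwith_in (vertex m) (fun i => M i : Type)).
Qed.

(** The action of the sum of all arrows on the product of the spaces. Iterating
    it gives the action of all paths of a given length, without composing maps
    between spaces with dependent indices. *)
Definition shift u (j : vertex m) : M j :=
  match (0 < j)%N =P true with
  | ReflectT j0 => rmap M (arrow_prev j0) (u (prev_vertex j))
  | ReflectF _ => 0
  end.

Lemma shiftE u i j (a : arrow i j) : shift u j = rmap M a (u i).
Proof.
rewrite /shift; case: (_ =P true) => [j0|].
  have ij : i = prev_vertex j.
    by apply: val_inj; move: a; rewrite /arrow => /eqP /= <-.
  by subst i; rewrite (bool_irrelevance a (arrow_prev j0)).
by case; have := a; rewrite /arrow => /eqP ij; rewrite -ij.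
Qed.

Lemma shift_first u (j : vertex m) : j = 0%N :> nat -> shift u j = 0.
Proof.
move=> j0; rewrite /shift; case: (_ =P true) => // j_gt0.
by exfalso; move: j_gt0; rewrite j0.
Qed.

Lemma iter_shift_small u k (j : vertex m) : (j < k)%N -> iter k shift u j = 0.
Proof.
elim: k j => // k IH j jk; rewrite iterS.
have [j0|j_gt0] := posnP j; first exact: shift_first.
by rewrite (shiftE _ (arrow_prev j_gt0)) IH ?linear0 //=; lia.
Qed.

(** A path of length at least 2 ending at an even vertex ends with a
    relation; a path of length at least 3 contains one. *)
Lemma iter_shift2 u k (j : vertex m) : ~~ odd j -> iter k.+2 shift u j = 0.
Proof.
move=> ev; have [jk|kj] := ltnP j k.+2; first exact: iter_shift_small.
have j_gt0 : (0 < j)%N by lia.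
have p_gt0 : (0 < prev_vertex j)%N by move=> /=; lia.
rewrite /= (shiftE _ (arrow_prev j_gt0)) (shiftE _ (arrow_prev p_gt0)).
by rewrite -comp_lfunE rmap_rel ?zero_lfunE //=; lia.
Qed.

Lemma iter_shift3 u k (j : vertex m) : iter k.+3 shift u j = 0.
Proof.
have [jo|/iter_shift2-> //] := boolP (odd j).
have j_gt0 : (0 < j)%N by lia.
by rewrite iterS (shiftE _ (arrow_prev j_gt0)) iter_shift2 ?linear0 //=; lia.
Qed.

(** The images of the component of u at x under the paths starting at x; the
    value at i is meaningful for x <= i. *)
Definition orbit u x (i : vertex m) : M i := iter (i - x) shift u i.

Lemma orbitE u x i j (a : arrow i j) : (x <= i)%N ->
  rmap M a (orbit u x i) = orbit u x j.
Proof.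
move=> xi; rewrite /orbit (_ : (j - x = (i - x).+1)%N) ?iterS ?(shiftE _ a) //.
by move: a; rewrite /arrow; lia.
Qed.

Lemma orbit_reach u x (i : vertex m) : (reach x < i)%N -> orbit u x i = 0.
Proof.
rewrite /reach /orbit => xi; have [io|ie] := boolP (odd i).
  by rewrite (_ : (i - x)%N = (i - x - 3).+3) ?iter_shift3 //; lia.
by rewrite (_ : (i - x)%N = (i - x - 2).+2) ?iter_shift2 //; lia.
Qed.

Lemma orbit_start u (x : vertex m) : orbit u x x = u x.
Proof. by rewrite /orbit subnn. Qed.

End Sections.

Section Projectives.

Context {F : fieldType} {m : nat}.
Implicit Types M : rep F m.

Lemma hom_from_projective M (x : vertex m) (v : M x) :
  exists f : hom (itv x (reach x)) M, f x (itv_gen x (reach x) x) = v.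
Proof.
have [u <-] := section_through v.
have [|f fE] := @hom_from_itv F m M x (reach x) (orbit u x) (leqnn _).
  move=> i j a /andP[xi _]; rewrite orbitE //.
  by case: ltnP => // /orbit_reach->.
exists f; rewrite fE entry_gen1 ?scale1r ?orbit_start //.
by rewrite /between /reach; lia.
Qed.

(** A map from [x, reach x] amounts to a vector at x, which lifts along an
    epimorphism. If x is not a vertex the interval is zero. *)
Lemma itv_projective x : projective (itv x (reach x) : rep F m).
Proof.
move=> X Y g f g_epi; have [x_m|x_m] := ltnP x (2 * m - 1).
  pose x' : vertex m := Ordinal x_m.
  have [v vE] := (limg_fullP _).1 (g_epi x') (f x' (itv_gen _ _ x')).
  have [h hE] := hom_from_projective v.
  exists h => i; apply/lfunP => w; apply/eqP; rewrite comp_lfunE -subr_eq0.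
  rewrite -[g i (h i w)]hom_compE -hom_subE; apply/eqP.
  apply: itv_hom_eq0 => // j jx _; have -> : j = x' by exact: val_inj.
  by rewrite !hom_simp hE vE subrr.
exists (hom_zero _ _) => i; apply/lfunP => w.
rewrite comp_lfunE zero_lfunE linear0; apply: itv_hom_eq0 => // j jx.
by have := ltn_ord j; rewrite jx ltnNge x_m.
Qed.

End Projectives.
Arguments itv_projective {F m} x X Y g f _.

(** * Classification of the indecomposable representations *)

(** The form is a left inverse of z |-> z v. *)
Lemma exists_linear_form (F : fieldType) (V : vectType F) (v : V) :
  v <> 0 -> exists f : 'Hom(V, F^o), f v = 1.
Proof.
move=> /eqP v0.
pose g (z : F^o) : V := z *: v.
have g_lin : linear g by move=> z x y; rewrite /g scalerDl scalerA.
pose gL := GRing.isLinear.Build F _ _ _ g g_lin.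
pose g' : {linear F^o -> V} := HB.pack g gL.
exists ((linfun g')^-1)%VF; rewrite -[v in LHS]scale1r.
rewrite -[1 *: v]/(g' 1) -(lfunE g') lker0_lfunK //.
apply/lker0P => y z; rewrite !lfunE /= /g => /eqP.
by rewrite -subr_eq0 -scalerBl scaler_eq0 (negPf v0) orbF subr_eq0 => /eqP.
Qed.

Section Classification.

Context {F : fieldType} {m : nat} (M : rep F m).
Implicit Types (u : forall i, M i) (f : forall i, 'Hom(M i, F^o)).

(** The transpose of [shift], acting on families of linear forms. *)
Definition coshift f (i : vertex m) : 'Hom(M i, F^o) :=
  match (i.+1 < 2 * m - 1)%N =P true with
  | ReflectT i1 => (f (Ordinal i1) \o rmap M (i := i) (j := Ordinal i1) (eqxx _))%VF
  | ReflectF _ => 0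
  end.

Lemma coshiftE f i j (a : arrow i j) : coshift f i = (f j \o rmap M a)%VF.
Proof.
rewrite /coshift; case: (_ =P true) => [i1|].
  have ij : j = Ordinal i1.
    by apply: val_inj; move: a; rewrite /arrow => /eqP /= <-.
  by subst j; congr (_ \o rmap M _)%VF; apply: bool_irrelevance.
by case; have := a; rewrite /arrow => /eqP ij; rewrite ij ltn_ord.
Qed.

Lemma coshift_adjoint k f u (i j : vertex m) : j = (i + k)%N :> nat ->
  f j (iter k shift u j) = iter k coshift f i (u i).
Proof.
elim: k f j => [|k IH] f j jk.
  by have -> : j = i by apply: val_inj; rewrite /= jk addn0.
have j_gt0 : (0 < j)%N by lia.
rewrite iterS (shiftE _ (arrow_prev j_gt0)) -comp_lfunE -coshiftE iterSr.
by apply: IH => /=; lia.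
Qed.

(** A path of maximal length among those acting by a nonzero map; no path of
    length 3 does. *)
Lemma longest_path : ~ is_zero M -> exists k u (b : vertex m),
  iter k shift u b <> 0 /\ forall u' j, iter k.+1 shift u' j = 0.
Proof.
move=> M_neq0.
have step k : (exists u (b : vertex m), iter k shift u b <> 0) \/
              (forall u (b : vertex m), iter k shift u b = 0).
  have [?|nex] := classic (exists u b, iter k shift u b <> 0); [by left|right].
  by move=> u b; apply: NNPP => ub; apply: nex; exists u, b.
have [[u [b ub]]|k2] := step 2%N.
  by exists 2%N, u, b; split=> // *; exact: iter_shift3.
have [[u [b ub]]|k1] := step 1%N; first by exists 1%N, u, b.
have [[u [b ub]]|k0] := step 0%N; first by exists 0%N, u, b.
case: M_neq0; apply/is_zeroP => i v.
by have [u <-] := section_through v; exact: k0.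
Qed.

(** A vector at a on which a longest path does not vanish generates a
    subrepresentation that is an interval from a to b. A linear form equal to 1 on the last vector of the chain, pulled back
    along the paths to b, defines a map onto this interval; maximality of the
    path makes both families compatible with the arrows entering a and leaving
    b. *)
Lemma itv_retract : ~ is_zero M -> exists a b : nat,
  [/\ (a <= b)%N, (b < 2 * m - 1)%N, (b <= reach a)%N
    & exists (f : hom M (itv a b)) (s : hom (itv a b) M),
        forall i, cancel (s i) (f i)].
Proof.
case/longest_path => k [u [b [ub k1]]].
have kb : (k <= b)%N by rewrite leqNgt; apply/negP => /iter_shift_small /ub.
pose a := (b - k)%N; have ab : (a <= b)%N by rewrite /a; lia.
have ba : (b - a)%N = k by rewrite /a; lia.
have b_reach : (b <= reach a)%N.
  by rewrite leqNgt; apply/negP => /(orbit_reach u); rewrite /orbit ba.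
exists a, b; split=> //; have am : (a < 2 * m - 1)%N by have := ltn_ord b; lia.
have [|s sE] := @hom_from_itv F m M a b (orbit u a) b_reach.
  move=> i j ar /andP[ai ib]; rewrite orbitE //; case: leqP => // bj.
  by rewrite /orbit (_ : (j - a)%N = k.+1) ?k1 //; move: ar; rewrite /arrow; lia.
have [phi phi1] := exists_linear_form ub.
pose Phi : forall i, 'Hom(M i, F^o) := dfwith (fun=> 0) phi.
have PhiE : Phi b = phi by rewrite /Phi dfwith_in.
pose psi (i : vertex m) : 'Hom(M i, F^o) := iter (b - i) coshift Phi i.
have [|f fE] := @hom_to_itv F m M a b psi b_reach.
  move=> i j ar v jab.
  have ij : j = i.+1 :> nat by move: ar; rewrite /arrow => /eqP.
  have /orP[iab|iab] := orbN (between a b i).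
    rewrite iab mulr1n /psi (_ : (b - i)%N = (b - j).+1) ?iterS.
      by rewrite (coshiftE _ ar) comp_lfunE.
    by move: jab; rewrite /between; lia.
  rewrite (negPf iab) mulr0n.
  have ja : j = a :> nat by move: jab iab; rewrite /between; lia.
  (* The arrow enters a: composed with the path from a to b it is too long. *)
  have [u' <-] := section_through v.
  rewrite /psi ja ba -(shiftE _ ar).
  rewrite -(@coshift_adjoint _ _ _ j b) -?iterSr ?k1 ?linear0 //.
  by rewrite ja /a; lia.
exists f, s => i v; rewrite fE; apply: itv_eq => iab.
rewrite entryZ entry_gen1 // mulr1 -[RHS]mulr1 sE linearZ /=.
congr (_ * _); rewrite /psi -(@coshift_adjoint _ _ (iter (i - a) shift u) i b).
  rewrite PhiE -iterD (_ : (b - i + (i - a))%N = k) //.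
  by move: iab; rewrite /between; lia.
by move: iab; rewrite /between; lia.
Qed.

End Classification.

Section IntervalModules.

Context {F : fieldType} {m : nat}.
Implicit Types (M N : rep F m) (a b c d : nat).

(** The pairs of bounds that label the nonzero interval modules: a bound b
    beyond the last vertex would give a second label to the same module. *)
Definition itv_bounds m a b := [&& (a <= b)%N, (b < 2 * m - 1)%N & (b <= reach a)%N].

(** The retract of [itv_retract] is nonzero, so its complement vanishes. *)
Lemma indecomposable_classification M : indecomposable M ->
  exists a b, itv_bounds m a b /\ iso M (itv a b).
Proof.
case=> M0 dec; have [a [b [ab bm ba [f [s sK]]]]] := itv_retract M0.
exists a, b; split; first exact/and3P.
have [/is_zeroP I0|/is_zeroP K0] := dec _ _ (retract_splits sK).
  by case: (@itv_gen_neq0 F m a b (Ordinal bm) _ (I0 _ _)); rewrite /between /= ab leqnn.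
exists f => i; exists (s i) => [v|]; last exact: sK.
have [|p pE] := @ker_lift _ _ _ _ f M (hom_sub (hom_id M) (hom_comp s f)).
  by move=> j w; rewrite !hom_simp linearB /= sK subrr.
have /eqP := pE i v; rewrite (K0 i (p i v)) linear0 !hom_simp eq_sym subr_eq0.
by move/eqP.
Qed.

(** In a decomposition into X and Y, the generator has a zero component in X
    or in Y, because the space at a is a line; then the component of every
    vector in that summand is zero. *)
Lemma itv_indecomposable a b : itv_bounds m a b ->
  indecomposable (itv a b : rep F m).
Proof.
case/and3P=> ab bm ba; have am := leq_ltn_trans ab bm.
pose a' : vertex m := Ordinal am.
have aab : between a b a' by rewrite /between /= leqnn.
split=> [/is_zeroP I0|X Y [f bf]]; first exact: (itv_gen_neq0 aab).
have fE i j (ar : arrow i j) v :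
    (f j (rmap (itv a b) ar v)) = (rmap X ar (f i v).1, rmap Y ar (f i v).2).
  by rewrite homE [LHS]dsum_mapE.
pose p1 i := (linfun (fst : X i * Y i -> X i) \o f i)%VF.
pose p2 i := (linfun (snd : X i * Y i -> Y i) \o f i)%VF.
have p1E i v : p1 i v = (f i v).1 by rewrite comp_lfunE lfunE.
have p2E i v : p2 i v = (f i v).2 by rewrite comp_lfunE lfunE.
have c1 i j (ar : arrow i j) v : p1 j (rmap (itv a b) ar v) = rmap X ar (p1 i v).
  by rewrite !p1E fE.
have c2 i j (ar : arrow i j) v : p2 j (rmap (itv a b) ar v) = rmap Y ar (p2 i v).
  by rewrite !p2E fE.
have line (w : X a' * Y a') : exists z : F, w = z *: f a' (itv_gen a b a').
  have [f' _ f'K] := bf a'; rewrite -[w]f'K (itv_genE (f' w)) linearZ.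
  by eexists.
case E : (f a' (itv_gen a b a')) => [x y].
have [x0|y0] : x = 0 \/ y = 0.
  have [z] := line (x, 0); rewrite E => -[xz /esym/eqP].
  by rewrite scaler_eq0 => /orP[/eqP z0|/eqP]; [left; rewrite xz z0 scale0r|right].
- left; apply/is_zeroP => i v; have [f' _ f'K] := bf i.
  have <- : (f i (f' (v, 0))).1 = v by rewrite f'K.
  rewrite -p1E; apply: (@itv_hom_eq0 _ _ _ _ _ (hom_of c1)) => // j ja _.
  by rewrite (_ : j = a') ?[LHS]p1E ?E //; apply: val_inj.
right; apply/is_zeroP => i v; have [f' _ f'K] := bf i.
have <- : (f i (f' (0, v))).2 = v by rewrite f'K.
rewrite -p2E; apply: (@itv_hom_eq0 _ _ _ _ _ (hom_of c2)) => // j ja _.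
by rewrite (_ : j = a') ?[LHS]p2E ?E //; apply: val_inj.
Qed.

Lemma itv_iso_support a b c d : iso (itv a b : rep F m) (itv c d) ->
  forall i : vertex m, between a b i -> between c d i.
Proof.
case=> f bf i iab; apply/negPn/negP => icd; apply: (itv_gen_neq0 iab).
apply: (bij_inj (bf i)); apply: itv_eq => icd'.
by rewrite icd' in icd.
Qed.

Lemma itv_iso_inj a b c d : itv_bounds m a b -> itv_bounds m c d ->
  iso (itv a b : rep F m) (itv c d) -> (a, b) = (c, d).
Proof.
move=> /and3P[ab bm _] /and3P[cd dm _] ac.
have := itv_iso_support ac; have := itv_iso_support (iso_sym ac).
have lt x y : (x <= y)%N -> (y < 2 * m - 1)%N -> (x < 2 * m - 1)%N.
  exact: leq_ltn_trans.
move=> /(_ (Ordinal dm)) /[dup] _; rewrite /between /= => Hd.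
move=> /[dup] /(_ (Ordinal bm)) /= Hb /(_ (Ordinal (lt _ _ ab bm))) /= Ha.
have := itv_iso_support (iso_sym ac) (i := Ordinal (lt _ _ cd dm)).
by rewrite /between /= => Hc; congr (_, _); lia.
Qed.

End IntervalModules.

(** * Projective resolutions of the interval modules *)

(** The first vertices of the terms of the resolution of the interval [a, b].
    The kernel of the projective cover of [a, b] is the interval from b + 1 to
    reach a, so each kernel starts right after the end of the interval before
    last. *)
Fixpoint res_top a b k :=
  match k with
  | 0 => a
  | 1 => b.+1
  | (k'.+1).+1 => (reach (res_top a b k')).+1
  end%N.

Lemma reach_mono x y : (x <= y)%N -> (reach x <= reach y)%N.
Proof. by rewrite /reach; lia. Qed.

Lemma res_top_mono a b k : (a <= b <= reach a)%N ->
  (res_top a b k <= res_top a b k.+1)%N.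
Proof.
case/andP=> ab ba.
elim/ltn_ind: k => -[|[|k]] IH; first by rewrite /=; lia.
  by rewrite /=; lia.
by rewrite [X in (X <= _)%N]/= [X in (_ <= X)%N]/= ltnS reach_mono ?IH.
Qed.

(** From degree 2 on all terms start at even vertices, and there the sequence
    advances by 2 every two steps: consecutive terms coincide in pairs. *)
Lemma res_top_pairs a b k : (a <= b <= reach a)%N ->
  res_top a b k.+2 = res_top a b k.+3 \/ res_top a b k.+3 = res_top a b k.+4.
Proof.
move=> ab; elim: k => [|k [IH|IH]]; last by left.
  by move: ab; rewrite /= /reach; lia.
by right; rewrite [LHS]/= [RHS]/= -/(res_top a b k.+2) -/(res_top a b k.+3) IH.
Qed.

Section Resolution.

Context {F : fieldType} {m : nat}.

(** Exactness at the middle interval: at each of its vertices, exactly one of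
    the outer intervals contributes a line. *)
Lemma itv_exact a1 b1 a2 b2 a3 b3 H H' :
  (forall i, between a2 b2 i -> between a1 b1 i = ~~ between a3 b3 i) ->
  exact_at (@itv_hom F m 1 a1 b1 a2 b2 H) (@itv_hom F m 1 a2 b2 a3 b3 H').
Proof.
move=> ex i; apply/limg_lkerP; split=> [u|v].
  apply: itv_eq => i3; rewrite entry0 !entry_itv_hom i3 !mulr1 mulr1n.
  have /orP[i2|/negPf->] := orbN (between a2 b2 i); last by rewrite mulr0n.
  by rewrite entry_out ?mul0rn // ex // i3.
have /orP[i2|i2] := orbN (between a2 b2 i); last first.
  by exists 0; rewrite linear0; apply: itv_eq => i2'; rewrite i2' in i2.
move/(congr1 (@entry F _)); rewrite entry0 entry_itv_hom mulr1.
have /orP[i1 _|i1] := orbN (between a1 b1 i).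
  exists (entry (v : 'rV_(between a2 b2 i)) *: itv_gen a1 b1 i).
  by rewrite itv_homE entryZ entry_gen1 // !mulr1; apply: itv_genE.
have i3 : between a3 b3 i by apply/negPn; rewrite -ex.
rewrite i3 mulr1n => v0; exists 0; rewrite linear0.
by apply: itv_eq => _; rewrite entry0.
Qed.

Variables (a b : nat) (ab : (a <= b <= reach a)%N).

Let x := res_top a b.

Definition itv_res_obj k : rep F m := itv (x k) (reach (x k)).

Lemma itv_res_diff_subproof k : [&& x k <= x k.+1, reach (x k) <= reach (x k.+1),
  reach (x k.+1) <= reach (x k.+1) & reach (x k) <= reach (x k)]%N.
Proof. by rewrite !leqnn res_top_mono //= reach_mono // res_top_mono. Qed.

Definition itv_res_diff k : hom (itv_res_obj k.+1) (itv_res_obj k) :=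
  itv_hom 1 (itv_res_diff_subproof k).

Lemma itv_res_aug_subproof :
  [&& a <= a, b <= reach a, reach a <= reach a & b <= reach a]%N.
Proof. by rewrite !leqnn; case/andP: ab => _ ->. Qed.

Definition itv_res_aug : hom (itv_res_obj 0) (itv a b) :=
  itv_hom 1 itv_res_aug_subproof.

Lemma itv_res_epi : epi itv_res_aug.
Proof.
move=> i; apply/limg_fullP => v.
exists (entry (v : 'rV_(between a b i)) *: itv_gen a (reach a) i).
rewrite itv_homE mulr1 entryZ; apply: itv_eq => iab.
rewrite entryZ entry_gen1 // mulr1 entry_gen1 ?mulr1 //.
by move: iab ab; rewrite /between /x /=; lia.
Qed.

Lemma itv_res_exact0 : exact_at (itv_res_diff 0) itv_res_aug.
Proof.
apply: itv_exact => i; move: ab; rewrite /between /x /= => /andP[h1 h2].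
by have := @reach_mono a b.+1 ltac:(lia); lia.
Qed.

Lemma itv_res_exactS k : exact_at (itv_res_diff k.+1) (itv_res_diff k).
Proof.
apply: itv_exact => i; rewrite /between.
have := res_top_mono k ab; have := res_top_mono k.+1 ab.
have := reach_mono (res_top_mono k.+1 ab); rewrite -/x.
by have : x k.+2 = (reach (x k)).+1 by []; lia.
Qed.

Definition itv_res : proj_resolution (itv a b : rep F m) :=
  ProjRes (fun k => itv_projective (x k)) itv_res_epi itv_res_exact0
    itv_res_exactS.

End Resolution.

(** * A numerical criterion for exceptional pairs *)

Lemma between_start x : between x (reach x) x.
Proof. by rewrite /between /reach; lia. Qed.

Section Criterion.

Context {F : fieldType} {m : nat}.
Implicit Types (a b c d : nat).

Lemma hom_itv_eq0 a b c d (f : hom (itv a b : rep F m) (itv c d)) :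
  (b <= reach a)%N -> ~~ between c d a -> forall i v, f i v = 0.
Proof.
move=> ba acd; apply: itv_hom_eq0 => // i ia _; apply: itv_eq.
by move=> icd; rewrite -ia icd in acd.
Qed.

(** The space of maps between two intervals is at most a line. *)
Lemma hom_itv_scalar a b c d H (f : hom (itv a b : rep F m) (itv c d)) :
  exists z, forall i v, f i v = itv_hom z H i v.
Proof.
have ba : (b <= reach a)%N by case/and4P: H.
have eq0 z : (forall i : vertex m, i = a :> nat -> (a <= b)%N ->
    hom_sub f (itv_hom z H) i (itv_gen a b i) = 0) ->
    forall i v, f i v = itv_hom z H i v.
  move=> fz i v; apply/eqP; rewrite -subr_eq0 -hom_subE; apply/eqP.
  exact: itv_hom_eq0.
have [am|am] := ltnP a (2 * m - 1); last first.
  by exists 0; apply: eq0 => i ia; have := ltn_ord i; rewrite ia ltnNge am.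
pose i : vertex m := Ordinal am.
exists (entry (f i (itv_gen a b i) : 'rV_(between c d i))); apply: eq0 => j ja ab.
have -> : j = i by exact: val_inj.
rewrite hom_subE itv_homE entry_gen1 ?mul1r -?itv_genE ?subrr //.
by rewrite /between /= leqnn.
Qed.

Variables (a b c d : nat) (ab : (a <= b <= reach a)%N)
  (cd : itv_bounds m c d).

Let x := res_top a b.
Let M : rep F m := itv c d.
Let inM k := between c d (x k).

Let dm : (d < 2 * m - 1)%N. Proof. by case/and3P: cd. Qed.

Lemma itv_hom_cond k : inM k ->
  [&& c <= x k, d <= reach (x k), reach (x k) <= reach (x k) & d <= reach c]%N.
Proof.
case/and3P: cd => _ _ dc /andP[cx _].
by rewrite cx leqnn dc (leq_trans dc) ?reach_mono.
Qed.

(** The complex Hom(P, M) has a line in each degree k with x k between c and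
    d, and its differential joins two such lines in consecutive degrees
    isomorphically: in degree k + 1 a cocycle is a coboundary when degree k has
    a line, and there is no nonzero cocycle when degree k + 2 has one. *)
Lemma acyclic_itv k :
  acyclic_at M (itv_res ab) k.+1 <-> (inM k.+1 -> inM k || inM k.+2).
Proof.
split=> [ac xS|ok f f_coc].
  apply/negPn/negP; rewrite negb_or => /andP[x0 x2].
  have xm : (x k.+1 < 2 * m - 1)%N.
    by case/andP: xS => _ xd; exact: leq_ltn_trans xd dm.
  pose i : vertex m := Ordinal xm.
  have [|g gE] := ac (itv_hom 1 (itv_hom_cond xS)).
    move=> j; apply/lfunP => v; rewrite zero_lfunE comp_lfunE -hom_compE.
    exact: hom_itv_eq0.
  have := gE i; move/lfunP/(_ (itv_gen _ _ i)).
  rewrite comp_lfunE (hom_itv_eq0 _ _ x0) // itv_homE entry_gen1.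
    by rewrite mulr1 scale1r; apply: itv_gen_neq0.
  exact: between_start.
have [xS|xS] := boolP (inM k.+1); last first.
  exists (hom_zero _ _) => i; apply/lfunP => v.
  by rewrite (hom_itv_eq0 _ _ xS) // comp_lfunE zero_lfunE.
have [z fE] := hom_itv_scalar (itv_hom_cond xS) f.
have := res_top_mono k ab; have := res_top_mono k.+1 ab; rewrite -/x => mono1 mono0.
case/orP: (ok xS) => [x0|x2].
  exists (itv_hom z (itv_hom_cond x0)) => i; apply/lfunP => v.
  rewrite comp_lfunE fE; apply: itv_eq => icd.
  rewrite !entry_itv_hom mulr1.
  have /orP[i1|/entry_out->] := orbN (between (x k.+1) (reach (x k.+1)) i); last first.
    by rewrite !(mul0r, mul0rn).
  rewrite [between (x k) _ i](_ : _ = true) //.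
  case/and4P: (itv_hom_cond x0) => _ dx _ _.
  by move: icd i1 mono0; rewrite /between -/(x k); lia.
have xm : (x k.+2 < 2 * m - 1)%N.
  by case/andP: x2 => _ xd; exact: leq_ltn_trans xd dm.
pose i : vertex m := Ordinal xm.
have z0 : z = 0.
  have := f_coc i; move/lfunP/(_ (itv_gen _ _ i)); rewrite comp_lfunE zero_lfunE.
  rewrite fE => /(congr1 (@entry F _)).
  rewrite entry0 !entry_itv_hom [between c d _](_ : _ = true) // mulr1n.
  rewrite entry_gen1 ?mul1r; last first.
    exact: between_start.
  rewrite [between (x k.+1) _ _](_ : _ = true) ?mul1r //.
  case/and4P: (itv_hom_cond xS) => _ dx _ _; case/andP: x2 => _ xd.
  by rewrite /between /= mono1 (leq_trans xd).
exists (hom_zero _ _) => j; apply/lfunP => v.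
by rewrite fE itv_homE z0 mulr0 scale0r comp_lfunE zero_lfunE.
Qed.

(** A map f from [a, b] to [c, d], composed with the projective cover, is
    multiplication by a scalar z. If b + 1 lies in [c, d], then z can be read
    off there; it is zero because [a, b] vanishes at b + 1. *)
Lemma hom_itv_vanish :
  (forall f : hom (itv a b) M, hom_eq0 f) <-> (inM 0 -> inM 1).
Proof.
case/andP: (ab) => a_b b_a; case/and3P: (cd) => c_d _ d_c.
split=> [f0 x0|ok f].
  apply/negPn/negP => x1; case/andP: (x0) => ca ad.
  have am : (a < 2 * m - 1)%N by exact: leq_ltn_trans ad dm.
  have H : [&& c <= a, d <= b, b <= reach a & d <= reach c]%N.
    by rewrite ca b_a d_c; move: x0 x1; rewrite /inM /between /x /=; lia.
  have /lfunP/(_ (itv_gen a b (Ordinal am))) := f0 (itv_hom 1 H) (Ordinal am).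
  rewrite itv_homE zero_lfunE entry_gen1 ?mulr1 ?scale1r.
    exact: itv_gen_neq0.
  by rewrite /between /= leqnn.
suff fa0 i v : f i v = 0 by move=> i; apply/lfunP => v; rewrite fa0 zero_lfunE.
have [x0|x0] := boolP (inM 0); last exact: hom_itv_eq0.
have x1 := ok x0.
have [u ->] := (limg_fullP _).1 (itv_res_epi ab i) v.
have [z fE] := hom_itv_scalar (itv_hom_cond x0) (hom_comp f (itv_res_aug ab)).
rewrite -hom_compE fE.
have bm : (b.+1 < 2 * m - 1)%N.
  by case/andP: x1 => _ xd; exact: leq_ltn_trans xd dm.
pose w : (itv_res_obj a b 0 : rep F m) (Ordinal bm) :=
  itv_gen (x 0) (reach (x 0)) (Ordinal bm).
have aug0 : itv_res_aug ab (Ordinal bm) w = 0.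
  by apply: itv_eq; rewrite /between /=; lia.
have := fE (Ordinal bm) w; rewrite hom_compE aug0 linear0.
move/esym/(congr1 (@entry F _)); rewrite entry_itv_hom entry0.
rewrite [between c d _]x1 mulr1n entry_gen1 ?mul1r.
  by move=> ->; rewrite itv_homE mulr0 scale0r.
case/and4P: (itv_hom_cond x0) => _ dx _ _; case/andP: x1 => _ xd.
by rewrite /between; move: dx xd; rewrite /x /=; lia.
Qed.

Lemma exceptional_itv_res : exceptional_pair M (itv a b) <->
  (inM 0 -> inM 1) /\ forall k, inM k.+1 -> inM k || inM k.+2.
Proof.
split=> [[H0 Hk]|[H0 Hk]].
  split=> [|k]; first exact/hom_itv_vanish.
  by apply/acyclic_itv; have [P /acyclic_at_indep] := Hk k.+1 isT; apply.
split=> [|[//|k] _]; first exact/hom_itv_vanish.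
by exists (itv_res ab); apply: (acyclic_itv k).2 (Hk k).
Qed.

End Criterion.

(** The criterion in degrees 0, 1 and 2, for M and N the intervals with bounds
    p and q; x2 and x3 start the terms of degree 2 and 3 of the resolution
    of N. *)
Definition itv_exceptional (p q : nat * nat) :=
  let inM i := between p.1 p.2 i in
  let a := q.1 in let b := q.2 in
  let x2 := (reach a).+1 in let x3 := (reach b.+1).+1 in
  [&& inM a ==> inM b.+1, inM b.+1 ==> inM a || inM x2
    & inM x2 ==> inM b.+1 || inM x3].

(** In degree 3 and above the condition holds because the terms of the
    resolution coincide in pairs. *)
Lemma exceptional_itvP (F : fieldType) m a b c d :
  itv_bounds m a b -> itv_bounds m c d ->
  exceptional_pair (itv c d : rep F m) (itv a b) <->
  itv_exceptional (c, d) (a, b).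
Proof.
move=> abm cdm; have ab : (a <= b <= reach a)%N.
  by case/and3P: abm => -> _ ->.
apply: iff_trans (exceptional_itv_res ab cdm) _.
rewrite /itv_exceptional /=; split=> [[/implyP H0 Hk]|/and3P[/implyP H0 H1 H2]].
  by apply/and3P; split=> //; apply/implyP; [apply: (Hk 0%N)|apply: (Hk 1%N)].
split=> // -[|[|k]]; [exact/implyP|exact/implyP|].
move=> inM3; apply/orP; have [E|E] := res_top_pairs k ab; [left|right].
  exact: etrans (congr1 (between c d) E) inM3.
exact: etrans (congr1 (between c d) (esym E)) inM3.
Qed.

(** * Counting *)

Section Counting.

Local Open Scope nat_scope.

Implicit Types (p q : nat * nat) (s t : seq (nat * nat)).

Definition translate n p := (2 * n + p.1, 2 * n + p.2).

(** The intervals ending at one of the two vertices 3 and 4. *)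
Definition window := [:: (1, 3); (2, 3); (3, 3); (3, 4); (4, 4)].

(** The bounds of the interval modules for m = k + 2: increasing k by one adds
    two vertices, hence the intervals ending there, a translated window. *)
Fixpoint intervals k :=
  if k is k'.+1 then intervals k' ++ map (translate k') window
  else [:: (0, 0); (0, 1); (1, 1); (1, 2); (2, 2)].

Lemma intervalsS k :
  intervals k.+1 = intervals k ++ map (translate k) window.
Proof. by []. Qed.

Definition num_exc s t := count (fun pq => itv_exceptional pq.1 pq.2)
  [seq (p, q) | p <- s, q <- t].

Lemma size_intervals k : size (intervals k) = 5 * k.+1.
Proof. by elim: k => //= k IH; rewrite size_cat IH /=; lia. Qed.

Lemma mem_intervals k p : (p \in intervals k) = itv_bounds k.+2 p.1 p.2.
Proof.
case: p => a b; elim: k => [|k IH].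
  rewrite /= !inE !xpair_eqE /itv_bounds /reach /=; lia.
rewrite /= mem_cat IH /= !inE !xpair_eqE /itv_bounds /reach /=; lia.
Qed.

Lemma uniq_intervals k : uniq (intervals k).
Proof.
elim: k => // k IH; rewrite intervalsS cat_uniq IH map_inj_uniq; last first.
  by move=> [a b] [c d]; rewrite /translate /= => -[? ?]; congr (_, _); lia.
rewrite andbT; apply/hasPn => -[a b] ab; rewrite mem_intervals.
by move: ab; rewrite /= !inE !xpair_eqE /itv_bounds /=; lia.
Qed.

Lemma num_exc_catl s1 s2 t : num_exc (s1 ++ s2) t = num_exc s1 t + num_exc s2 t.
Proof. by rewrite /num_exc allpairs_cat count_cat. Qed.

Lemma num_exc_catr s t1 t2 : num_exc s (t1 ++ t2) = num_exc s t1 + num_exc s t2.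
Proof.
elim: s => // p s; rewrite /num_exc !allpairs_cons map_cat !count_cat => ->.
exact: addnACA.
Qed.

Lemma itv_exceptional_translate n p q :
  itv_exceptional (translate n p) (translate n q) = itv_exceptional p q.
Proof.
have reachD x : (reach (2 * n + x)).+1 = 2 * n + (reach x).+1.
  by rewrite /reach mul2n oddD odd_double; lia.
have betweenD c d x : between (2 * n + c) (2 * n + d) (2 * n + x) = between c d x.
  by rewrite /between !leq_add2l.
by rewrite /itv_exceptional /= -[(_ + q.2).+1]addnS !reachD !betweenD.
Qed.

Lemma num_exc_translate n s t :
  num_exc (map (translate n) s) (map (translate n) t) = num_exc s t.
Proof.
pose f pq := (translate n pq.1, translate n pq.2).
rewrite /num_exc allpairs_mapl allpairs_mapr -(map_allpairs f pair) count_map.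
by apply: eq_count => pq /=; rewrite itv_exceptional_translate.
Qed.

Lemma num_exc_all s t :
  (forall p q, p \in s -> q \in t -> itv_exceptional p q) ->
  num_exc s t = size s * size t.
Proof.
move=> st; rewrite /num_exc -(size_allpairs pair s t); apply/eqP.
by rewrite -all_count; apply/allP => _ /allpairsP[[p q] [ps qt ->]]; exact: st.
Qed.

Lemma translateD i j s :
  map (translate (i + j)) s = map (translate i) (map (translate j) s).
Proof.
rewrite -map_comp; apply: eq_map => -[a b] /=.
by rewrite /translate /=; congr (_, _); lia.
Qed.

(** Intervals that are far apart: in the one order all terms of the resolution
    start beyond [a, b], in the other order the terms of degree at most 2 start
    before [c, d]. *)
Lemma far_exceptional k p q :
  p \in intervals k -> q \in map (translate (k + 2)) window ->
  itv_exceptional p q /\ itv_exceptional q p.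
Proof.
case: p q => [a b] [c d]; rewrite mem_intervals /itv_bounds /= => pb qw.
have ck : 2 * k + 5 <= c <= d.
  by move: qw; rewrite /= !inE /translate /= !xpair_eqE; lia.
rewrite /itv_exceptional /between /=; move: pb; rewrite /reach; lia.
Qed.

(** Only the last ten of the old intervals are close to the five new ones. They
    form with them a number of exceptional pairs that does not depend on k, by
    translation; all pairs of a new interval with another old one are
    exceptional. *)
Lemma num_exc_intervals k :
  num_exc (intervals k.+1) (intervals k.+1) + 77 * k.+3
  = 25 * k.+3 ^ 2 + 68.
Proof.
(* The recursion starts at k = 2, where there are ten old intervals to cut off. *)
elim/ltn_ind: k => -[|[|k]] IH; [by vm_compute|by vm_compute|].
have IH' := IH k.+1 (leqnn _).
pose near := window ++ map (translate 1) window.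
have cutE : intervals k.+2 = intervals k ++ map (translate k) near.
  by rewrite /near map_cat -translateD addn1 catA.
pose new := map (translate (k + 2)) window.
have newE : new = map (translate k) (map (translate 2) window).
  exact: translateD.
have -> : intervals k.+3 = intervals k.+2 ++ new by rewrite /new addn2.
have far1 : num_exc (intervals k) new = 5 * k.+1 * 5.
  rewrite num_exc_all ?size_intervals ?size_map // => p q pI qn.
  by have [] := far_exceptional pI qn.
have far2 : num_exc new (intervals k) = 5 * (5 * k.+1).
  rewrite num_exc_all ?size_intervals ?size_map // => p q pn qI.
  by have [] := far_exceptional qI pn.
have nearl : num_exc near (map (translate 2) window) = 44 by vm_compute.
have nearr : num_exc (map (translate 2) window) near = 42 by vm_compute.
have new2 : num_exc window window = 12 by vm_compute.
have oldnew : num_exc (intervals k.+2) new = 25 * k.+1 + 44.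
  by rewrite cutE num_exc_catl far1 newE num_exc_translate nearl; lia.
have newold : num_exc new (intervals k.+2) = 25 * k.+1 + 42.
  by rewrite cutE num_exc_catr far2 newE num_exc_translate nearr; lia.
have newnew : num_exc new new = 12 by rewrite num_exc_translate.
move: (intervals k.+2) oldnew newold IH' => old oldnew newold IH'.
rewrite num_exc_catl !num_exc_catr oldnew newold newnew; lia.
Qed.

End Counting.

(** * The number of exceptional pairs *)

(** The classes are represented by the pairs of intervals that satisfy the
    criterion; a representative is determined by its bounds
    ([itv_iso_inj]). *)
Lemma num_exceptional_pairs_intervals (F : fieldType) k :
  num_exceptional_pairs F k.+2 (num_exc (intervals k) (intervals k)).
Proof.
pose ok (pq : (nat * nat) * (nat * nat)) := itv_exceptional pq.1 pq.2.
pose L := [seq pq <- [seq (p, q) | p <- intervals k, q <- intervals k] | ok pq].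
have -> : num_exc (intervals k) (intervals k) = size L by rewrite size_filter.
have memL p q : ((p, q) \in L) = [&& itv_exceptional p q,
    itv_bounds k.+2 p.1 p.2 & itv_bounds k.+2 q.1 q.2].
  rewrite mem_filter -!mem_intervals; congr (_ && _).
  by apply/allpairsP/andP => [[[? ?] [? ? [-> ->]]]|[? ?]] //; exists (p, q).
have uniqL : uniq L.
  apply/filter_uniq/allpairs_uniq; try exact: uniq_intervals.
  by case=> [? ?] [? ?] _ _ [-> ->].
pose o : nat * nat := (0, 0)%N.
have nthL (i : 'I_(size L)) : exists p q, nth (o, o) L i = (p, q) /\
    [&& itv_exceptional p q, itv_bounds k.+2 p.1 p.2 & itv_bounds k.+2 q.1 q.2].
  have := mem_nth (o, o) (ltn_ord i); case: nth => p q; rewrite memL => pq.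
  by exists p, q.
pose I (p : nat * nat) : rep F k.+2 := itv p.1 p.2.
exists (fun i => let pq := nth (o, o) L i in (I pq.1, I pq.2)).
split=> [i|i j|[M N] /= [indM indN MN]].
- have [[c d] [[a b] [-> /and3P[E cd ab]]]] := nthL i.
  split; [exact: itv_indecomposable|exact: itv_indecomposable|].
  exact/exceptional_itvP.
- have [[c d] [[a b] [Ei /and3P[_ cd ab]]]] := nthL i.
  have [[c' d'] [[a' b'] [Ej /and3P[_ cd' ab']]]] := nthL j.
  rewrite Ei Ej /= => -[/itv_iso_inj pp' /itv_iso_inj qq'].
  apply/val_inj/eqP; rewrite -(nth_uniq (o, o) (ltn_ord i) (ltn_ord j) uniqL).
  by rewrite Ei Ej pp' // qq'.
have [c [d [cd Mcd]]] := indecomposable_classification indM.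
have [a [b [ab Nab]]] := indecomposable_classification indN.
have inL : ((c, d), (a, b)) \in L.
  rewrite memL /= ab cd !andbT; apply/(exceptional_itvP F ab cd).
  exact: exceptional_pair_iso MN.
have iL : (index ((c, d), (a, b)) L < size L)%N by rewrite index_mem.
by exists (Ordinal iL); rewrite /= nth_index.
Qed.

Theorem mainTheorem5 (F : closedFieldType) (m : nat) (hm : (2 <= m)%N) :
  num_exceptional_pairs F m
    (if m == 2%N then 12 else 25 * m ^ 2 + 68 - 77 * m)%N.
Proof.
case: m hm => [|[|k]] // _; have := @num_exceptional_pairs_intervals F k.
suff -> : num_exc (intervals k) (intervals k)
  = (if k.+2 == 2 then 12 else 25 * k.+2 ^ 2 + 68 - 77 * k.+2)%N by [].
case: k => [|k]; first by vm_compute.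
by rewrite -num_exc_intervals addnK.
Qed.
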